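(* Let $\pi(2,n)$ be the probability that the random game $G(2,n)$ is strict-dominance solvable. Then: 1. for any integer $n\ge1$, $\pi(2,n)=2W(n)=\dfrac{(2n-1)!!}{2^{n-1}\cdot n!}$; 2. $\pi(2,n)$ is strictly decreasing in $n$; 3. $\lim_{n\to\infty}n^{1/2}\cdot\pi(2,n)=\dfrac{2}{\sqrt{\pi}}$ (on the right-hand side $\pi$ is the usual constant).
   Context: Random game $G(m,n)$ ($m,n\ge1$ integers): there are two players, Row with action set $[m]=\{1,\dots,m\}$ and Column with action set $[n]$. Payoffs are given by $m\times n$ matrices $R=(r_{ij})$ (Row's payoffs) and $C=(c_{ij})$ (Column's payoffs). For each $j\in[n]$ the column $r_{\cdot j}=(r_{1j},\dots,r_{mj})$ is a uniformly random permutation of $[m]$; for each $i\in[m]$ the row $c_{i\cdot}=(c_{i1},\dots,c_{in})$ is a uniformly random permutation of $[n]$; all these $m+n$ random permutations are mutually independent. Dominance (by pure actions only): in a (sub)game with row set $Y\subseteq[m]$ and column set $X\subseteq[n]$, Row's action $i\in Y$ is strictly dominated if there is $i'\in Y$ with $r_{i'x}>r_{ix}$ for all $x\in X$; Column's action $j\in X$ is strictly dominated if there is $j'\in X$ with $c_{yj'}>c_{yj}$ for all $y\in Y$. Iterated elimination: in each round, both players simultaneously delete all their actions that are strictly dominated in the current subgame; the procedure stops when there are no strictly dominated actions. The game is strict-dominance solvable if exactly one action is left for each player at the end. Notation: $(2n-1)!!=1\cdot3\cdots(2n-1)$, $(2n)!!=2\cdot4\cdots(2n)$, and $W(n)=\dfrac{(2n-1)!!}{(2n)!!}=\dfrac{\Gamma(n+1/2)}{\Gamma(1/2)\Gamma(n+1)}$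 is the Wallis ratio. *)

(* Defs.v *)
From HB Require Import structures.
From mathcomp Require Import all_boot all_order all_algebra all_fingroup.
From mathcomp Require Import all_classical all_reals all_analysis.

Set Implicit Arguments.
Unset Strict Implicit.
Unset Printing Implicit Defensive.

Import Order.TTheory GRing.Theory Num.Theory.
Import numFieldNormedType.Exports.

(* R i j (resp. C i j) is the payoff of Row (resp. Column) when Row plays i and
   Column plays j. A subgame is a pair S of a set S.1 of rows and a set S.2 of
   columns. *)
Section Dominance.
Variables (m n : nat) (R C : 'M[nat]_(m, n)).
Implicit Type S : {set 'I_m} * {set 'I_n}.

Definition row_dominated S (i : 'I_m) : bool :=
  [exists i' in S.1, forall x in S.2, R i x < R i' x].

Definition col_dominated S (j : 'I_n) : bool :=
  [exists j' in S.2, forall y in S.1, C y j < C y j'].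

Definition eliminate S : {set 'I_m} * {set 'I_n} :=
  ([set i in S.1 | ~~ row_dominated S i],
   [set j in S.2 | ~~ col_dominated S j]).

Definition undominated S : Prop :=
  (forall i, i \in S.1 -> ~~ row_dominated S i) /\
  (forall j, j \in S.2 -> ~~ col_dominated S j).

Definition strict_dominance_solvable : Prop :=
  exists k : nat, let S := iter k eliminate (finset.setT, finset.setT) in
    [/\ undominated S, #|S.1| = 1 & #|S.2| = 1].

End Dominance.

(* The sample space of G(m,n): one permutation of the rows for each column and
   one permutation of the columns for each row. The uniform law on this finite
   product is exactly the joint law of m + n mutually independent, uniformly
   random permutations. *)
Definition game (m n : nat) : finType :=
  ({ffun 'I_n -> 'S_m} * {ffun 'I_m -> 'S_n})%type.

(* Payoffs range over 1..m and 1..n, whereas 'I_m and 'I_n start at 0. *)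
Definition row_payoff m n (g : game m n) : 'M[nat]_(m, n) :=
  \matrix_(i, j) (g.1 j i).+1.

Definition col_payoff m n (g : game m n) : 'M[nat]_(m, n) :=
  \matrix_(i, j) (g.2 i j).+1.

Local Open Scope ring_scope.

Definition solvable_prob (K : realType) (m n : nat) : K :=
  #|finset (fun g : game m n =>
      `[< strict_dominance_solvable (row_payoff g) (col_payoff g) >])|%:R
  / #|game m n|%:R.

(* (2n-1)!! = 1 * 3 * ... * (2n-1) and (2n)!! = 2 * 4 * ... * (2n) *)
Definition odd_dfact (n : nat) : nat := (\prod_(k < n) (2 * k + 1))%N.
Definition even_dfact (n : nat) : nat := (\prod_(k < n) (2 * (k + 1)))%N.

Definition wallis_ratio (K : realType) (n : nat) : K :=
  (odd_dfact n)%:R / (even_dfact n)%:R.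

(* Main.v *)
(* A column is eliminated in the first round iff it is Pareto-dominated, and the
   other columns stay undominated as long as both rows are present. Hence
   G(2, n) is solvable iff all Pareto-undominated columns have the same best row,
   which has conditional probability 2 / 2 ^ k, where k is the number of these
   columns. Sorting the columns by Column's payoff in the first row, k becomes the
   number of records of a uniform permutation, and E[x ^ k] is the product of
   the (x + i - 1) / i; at x = 1/2 this is the Wallis ratio W(n). The asymptotics
   come from comparing the integrals of consecutive powers of sin, which gives
   2n / ((2n + 1) pi) <= n W(n)^2 <= 1 / pi. *)

Require Import Defs.
From HB Require Import structures.
From mathcomp Require Import all_boot all_order all_algebra all_fingroup.
From mathcomp Require Import all_classical all_reals all_analysis.
From mathcomp Require Import ring lra zify.
Import Order.TTheory GRing.Theory Num.Theory.
Import numFieldNormedType.Exports.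

Set Implicit Arguments.
Unset Strict Implicit.
Unset Printing Implicit Defensive.

Local Open Scope classical_set_scope.
Local Open Scope ring_scope.

(** * Counting solvable games *)

Definition nonrecord n (s : 'S_n) (k : 'I_n) : bool :=
  [exists k' : 'I_n, (k < k')%N && (s k < s k')%N].

Lemma ltn_lift n (i : 'I_n.+1) (a b : 'I_n) :
  (lift i a < lift i b)%N = (a < b)%N.
Proof. by rewrite !ltnNge leq_bump2. Qed.

Lemma lift_perm0_bij n :
  bijective (fun p : 'I_n.+1 * 'S_n => lift_perm ord0 p.1 p.2).
Proof.
apply: inj_card_bij; last by rewrite card_prod !card_Sn !card_ord factS.
move=> [i s] [j t] /= /permP e.
have eij : i = j by have := e ord0; rewrite !lift_perm_id.
congr pair => //; apply/permP => k; apply: (@lift_inj _ i).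
by have := e (lift ord0 k); rewrite !lift_perm_lift -eij.
Qed.

(** Unless [i] is the maximal value, the maximum sits at a later position. *)
Lemma nonrecord_lift_perm0 n (i : 'I_n.+1) (s : 'S_n) :
  nonrecord (lift_perm ord0 i s) ord0 = (i < n)%N.
Proof.
set t := lift_perm ord0 i s; have t0 : t ord0 = i by exact: lift_perm_id.
apply/existsP/idP => [[k /andP[_]]|ltin].
  by rewrite t0 => /leq_trans; apply; rewrite -ltnS ltn_ord.
exists ((t^-1)%g ord_max); rewrite t0 permKV ltin andbT lt0n.
apply: contraTN ltin => /eqP e0; rewrite -leqNgt -t0.
have -> : ord0 = (t^-1)%g ord_max by apply: val_inj; rewrite /= e0.
by rewrite permKV.
Qed.

(** [lift i] is increasing, and position 0 comes after no other position. *)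
Lemma nonrecord_lift_perm n (i : 'I_n.+1) (s : 'S_n) (k : 'I_n) :
  nonrecord (lift_perm ord0 i s) (lift ord0 k) = nonrecord s k.
Proof.
apply/existsP/existsP => -[k'].
  case: (unliftP ord0 k') => [l|] -> //.
  by rewrite !lift_perm_lift !ltn_lift; exists l.
by exists (lift ord0 k'); rewrite !lift_perm_lift !ltn_lift.
Qed.

(* The value at position 0 of a permutation of [n + 1] letters is free, position
   0 is a record for exactly one of these values, and it does not influence
   which of the later positions are records. *)
Lemma sum_nonrecord n :
  (\sum_(s : 'S_n) \prod_(k < n) (if nonrecord s k then 2 else 1) =
   odd_dfact n)%N.
Proof.
elim: n => [|n IH].
  rewrite /odd_dfact big_ord0 (eq_bigr (fun=> 1%N)) => [|s _]; last first.
    by rewrite big_ord0.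
  by rewrite sum1_card card_Sn.
rewrite /odd_dfact big_ord_recr /= -/(odd_dfact n) -IH.
rewrite (reindex _ (onW_bij _ (lift_perm0_bij n))) /=.
rewrite -(pair_bigA _ (fun i s =>
  \prod_k (if nonrecord (lift_perm ord0 i s) k then 2 else 1))%N) /=.
under eq_bigr => i _ do under eq_bigr => s _ do
  (rewrite big_ord_recl nonrecord_lift_perm0;
   under eq_bigr => k _ do rewrite nonrecord_lift_perm).
under eq_bigr => i _ do rewrite -big_distrr /=.
rewrite -big_distrl /= mulnC; congr (_ * _)%N.
rewrite big_ord_recr /= ltnn; congr (_ + _)%N.
under eq_bigr => i _ do rewrite ltn_ord.
by rewrite sum_nat_const card_ord mulnC.
Qed.

(** * Pareto-dominated columns and records *)

Definition pareto_dominated n (h : {ffun 'I_2 -> 'S_n}) (j : 'I_n) : bool :=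
  [exists j', forall y, (h y j < h y j')%N].

Lemma forall_I2 (P : pred 'I_2) : [forall y, P y] = P 0 && P 1.
Proof.
apply/forallP/andP => [P01|[P0 P1] y]; first by split.
case: y => -[|[|//]] lt_y.
  by rewrite (_ : Ordinal _ = 0) //; apply: val_inj.
by rewrite (_ : Ordinal _ = 1) //; apply: val_inj.
Qed.

Definition ffun_of_pair {T} (p : T * T) : {ffun 'I_2 -> T} :=
  [ffun i : 'I_2 => if i == 0 then p.1 else p.2].

Lemma ffun_of_pair_bij (T : finType) : bijective (@ffun_of_pair T).
Proof.
apply: inj_card_bij; last by rewrite card_ffun card_ord card_prod expnS expn1.
move=> [a b] [c d] /ffunP e.
by have := e 1; have := e 0; rewrite !ffunE /= => -> ->.
Qed.

(* Ordering the columns by their payoff in row 0 turns the Pareto-dominated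
   columns into the non-records of the payoffs in row 1. *)
Lemma sum_pareto_dominated n :
  (\sum_(h : {ffun 'I_2 -> 'S_n})
     \prod_(j < n) (if pareto_dominated h j then 2 else 1) =
   n`! * odd_dfact n)%N.
Proof.
rewrite (reindex _ (onW_bij _ (ffun_of_pair_bij _))) /=.
rewrite -(pair_bigA _ (fun s t =>
  \prod_j (if pareto_dominated (ffun_of_pair (s, t)) j then 2 else 1))%N) /=.
rewrite (eq_bigr (fun=> odd_dfact n)) => [|s _]; last first.
  rewrite -sum_nonrecord.
  rewrite (reindex_inj (mulgI s)); apply: eq_bigr => t _.
  rewrite [RHS](reindex_inj (@perm_inj _ s)); apply: eq_bigr => j _.
  congr (if _ then _ else _).
  rewrite /pareto_dominated /nonrecord.
  apply/existsP/existsP => -[j'].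
    rewrite forall_I2 !ffunE /= !permM => H; by exists (s j').
  by exists ((s^-1)%g j'); rewrite forall_I2 !ffunE /= !permM permKV.
by rewrite sum_nat_const card_Sn.
Qed.

(** * Elimination in games of arbitrary size *)

Section EliminationGeneral.
Variables (m n : nat) (R C : 'M[nat]_(m, n)).
Implicit Type S : {set 'I_m} * {set 'I_n}.

Lemma singleton_undominated a j : undominated R C ([set a]%SET, [set j]%SET).
Proof.
split=> k /set1P ->; apply/negP => /existsP[k' /andP[/set1P -> /forallP]].
  by move=> /(_ j); rewrite set11 ltnn.
by move=> /(_ a); rewrite set11 ltnn.
Qed.

Lemma col_undominated_max S y j :
  y \in S.1 -> (forall j', j' \in S.2 -> (C y j' <= C y j)%N) ->
  ~~ col_dominated C S j.
Proof.
move=> yS maxj; apply/negP => /existsP[j' /andP[j'S /forallP /(_ y)]].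
by rewrite yS /= ltnNge maxj.
Qed.

Lemma row_undominated_max S i j :
  j \in S.2 -> (forall i', i' \in S.1 -> (R i' j <= R i j)%N) ->
  ~~ row_dominated R S i.
Proof.
move=> jS maxi; apply/negP => /existsP[i' /andP[i'S /forallP /(_ j)]].
by rewrite jS /= ltnNge maxi.
Qed.

Lemma in_eliminate_row S i :
  (i \in (eliminate R C S).1) = (i \in S.1) && ~~ row_dominated R S i.
Proof. by rewrite inE. Qed.

Lemma in_eliminate_col S j :
  (j \in (eliminate R C S).2) = (j \in S.2) && ~~ col_dominated C S j.
Proof. by rewrite inE. Qed.

(** A best reply to a present row is never dominated, so a round cannot delete all columns. *)
Lemma eliminate_col_max S y j :
  y \in S.1 -> j \in S.2 ->
  exists2 j', j' \in (eliminate R C S).2 &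
    forall j'', j'' \in S.2 -> (C y j'' <= C y j')%N.
Proof.
move=> yS jS; case: (@arg_maxnP _ j (fun x => x \in S.2) (C y) jS) => x xS maxx.
exists x => //; rewrite !inE xS /=.
by apply: (@col_undominated_max S y x yS) => j'; exact: maxx.
Qed.

End EliminationGeneral.

(** * Solvability of games with two rows *)

Lemma perm2_eq (p q : 'S_2) i i' :
  (p i < p i')%N -> (q i < q i')%N -> p = q.
Proof.
move=> pii' qii'.
have ne : i != i' by apply: contraTneq pii' => ->; rewrite ltnn.
have v (r : 'S_2) : (r i < r i')%N -> r i = 0 /\ r i' = 1.
  have := ltn_ord (r i); have := ltn_ord (r i').
  by move=> l l' lt; split; apply: val_inj; rewrite /= ?modn_small //; lia.
have [[pi pi'] [qi qi']] := (v _ pii', v _ qii').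
apply/permP => x.
have [->|] := eqVneq x i; first by rewrite pi qi.
have [->|] := eqVneq x i'; first by rewrite pi' qi'.
move: ne; rewrite -!(inj_eq val_inj) /=.
by have := ltn_ord x; have := ltn_ord i; have := ltn_ord i'; lia.
Qed.

Section TwoRows.
Variables (n : nat) (g : game 2 n).
Let R := row_payoff g.
Let C := col_payoff g.

Lemma col_dominated_pareto j :
  col_dominated C (finset.setT, finset.setT) j = pareto_dominated g.2 j.
Proof.
apply: eq_existsb => j'; rewrite inE /=; apply: eq_forallb => y.
by rewrite inE !mxE.
Qed.

(** After one round all remaining columns have the same best row [a], after two [a] is the only row,
    after three only its best reply is left. *)
Lemma solvable_if_unanimous p (j0 : 'I_n) :
  (forall j, ~~ pareto_dominated g.2 j -> g.1 j = p) ->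
  strict_dominance_solvable R C.
Proof.
(* [a] is the row to which [p] gives the highest payoff. *)
move=> una; pose a := (p^-1)%g ord_max.
pose T : {set 'I_2} * {set 'I_n} := (finset.setT, finset.setT).
pose S1 := eliminate R C T; pose S2 := eliminate R C S1; pose S3 := eliminate R C S2.
have S1p j : j \in S1.2 -> g.1 j = p.
  by rewrite !inE /= col_dominated_pareto => /una.
have S2p j : j \in S2.2 -> g.1 j = p by rewrite inE => /andP[/S1p].
have amax j : g.1 j = p -> forall i, (R i j <= R a j)%N.
  by move=> gj i; rewrite !mxE gj permKV ltnS -ltnS ltn_ord.
have [j1 j1S _] : exists2 j', j' \in S1.2 &
    forall j'', j'' \in T.2 -> (C a j'' <= C a j')%N.
  by apply: (@eliminate_col_max _ _ R C T a j0); rewrite inE.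
have aS1 : a \in S1.1.
  rewrite !inE /=; apply: (@row_undominated_max _ _ _ T a j1); rewrite ?inE //.
  by move=> i _; apply/amax/S1p.
have [j2 j2S _] := eliminate_col_max R C aS1 j1S.
have aS2 : S2.1 = [set a]%SET.
  apply/setP => i; rewrite in_eliminate_row finset.in_set1; have [->|ia] := eqVneq i a.
    by rewrite aS1; apply: (row_undominated_max j1S) => i' _; apply/amax/S1p.
  apply/negbTE; rewrite negb_and; apply/orP; right; rewrite negbK.
  apply/existsP; exists a; rewrite aS1; apply/forallP => j; apply/implyP => /S1p gj.
  (* Row's payoffs within a column are distinct, so the best row is strictly better. *)
  rewrite ltn_neqAle (amax _ gj) andbT !mxE gj eqSS.
  by rewrite (inj_eq val_inj) (inj_eq perm_inj).
have [j3 j3S j3max] : exists2 j', j' \in S3.2 &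
    forall j'', j'' \in S2.2 -> (C a j'' <= C a j')%N.
  by apply: (@eliminate_col_max _ _ R C S2 a j2); rewrite // aS2 set11.
have S3E : S3 = ([set a]%SET, [set j3]%SET).
  apply: injective_projections; apply/setP => i.
    rewrite in_eliminate_row aS2 [in RHS]/= finset.in_set1; case: eqP => [->|//] /=.
    by apply: (row_undominated_max j2S) => i' _; apply/amax/S2p.
  rewrite [in RHS]/= finset.in_set1; have [->|ij] := eqVneq i j3; first exact: j3S.
  rewrite in_eliminate_col.
  apply/negP => /andP[iS /negP]; apply; apply/existsP; exists j3.
  move: j3S; rewrite in_eliminate_col => /andP[-> _] /=; apply/forallP => y.
  rewrite -[y \in _]/(y \in S2.1) aS2 finset.in_set1; apply/implyP => /eqP ->.
  rewrite ltn_neqAle j3max // andbT !mxE eqSS.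
  by rewrite (inj_eq val_inj) (inj_eq perm_inj).
exists 3; rewrite -[iter 3 _ _]/S3 S3E /= !cards1; split=> //.
exact: singleton_undominated.
Qed.

(** While [j1] and [j2] are present, neither row dominates the other. Hence the first round only
    shrinks the columns to [U], and the result is a fixed point with two rows. *)
Lemma not_solvable_if_disagree j1 j2 :
  ~~ pareto_dominated g.2 j1 -> ~~ pareto_dominated g.2 j2 ->
  g.1 j1 <> g.1 j2 -> ~ strict_dominance_solvable R C.
Proof.
move=> u1 u2 ne.
pose T : {set 'I_2} * {set 'I_n} := (finset.setT, finset.setT).
pose U := [set j | ~~ pareto_dominated g.2 j]%SET.
have rowu (S : {set 'I_2} * {set 'I_n}) i :
    j1 \in S.2 -> j2 \in S.2 -> ~~ row_dominated R S i.
  move=> j1S j2S; apply/negP => /existsP[i' /andP[_ /forallP lt]]; apply: ne.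
  move: (lt j1) (lt j2); rewrite j1S j2S !mxE /=; exact: perm2_eq.
have E1 : eliminate R C T = (finset.setT, U).
  apply: injective_projections => /=; apply/setP => i;
    rewrite !inE ?col_dominated_pareto //.
  by rewrite rowu // !inE.
have E2 : eliminate R C (finset.setT, U) = (finset.setT, U).
  apply: injective_projections => /=; apply/setP => i; rewrite !inE.
    by rewrite rowu // !inE.
  (* With both rows present, dominance inside [U] is Pareto dominance in the full game. *)
  rewrite andb_idr // => /negP ui; apply/negP => /existsP[j /andP[_ /forallP lt]].
  apply: ui; apply/existsP; exists j; apply/forallP => y.
  by have := lt y; rewrite inE !mxE.
have rowsT k : (iter k (eliminate R C) T).1 = finset.setT.
  case: k => [//|k]; suff -> : iter k.+1 (eliminate R C) T = (finset.setT, U) by [].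
  by elim: k => [|k IH]; [exact: E1 | rewrite iterS IH E2].
by move=> [k [_]]; rewrite rowsT cardsT card_ord.
Qed.

End TwoRows.

(** * The number of solvable games *)

Lemma pareto_undominated_exists n (h : {ffun 'I_2 -> 'S_n.+1}) :
  exists j, ~~ pareto_dominated h j.
Proof.
(* The witness is Column's best reply to row 0. *)
exists ((h 0)^-1%g ord_max); apply/negP => /existsP[j /forallP /(_ 0)].
by rewrite permKV ltnNge -ltnS ltn_ord.
Qed.

Lemma prod_nat_of_bool (I : finType) (b : pred I) :
  (\prod_(i : I) b i = [forall i, b i])%N.
Proof.
case: forallP => [b1|nb]; first by rewrite big1 // => i _; rewrite b1.
have [i bi] : exists i, ~~ b i by apply/existsP; rewrite -negb_forall; apply/forallP.
by rewrite (bigD1 i) //= (negbTE bi) mul0n.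
Qed.

(** Splitting by the common preference [p] turns solvability into conditions on single columns. Some
    column is undominated, so at most one [p] contributes. *)
Lemma solvableE n (g : game 2 n.+1) :
  (`[< strict_dominance_solvable (row_payoff g) (col_payoff g) >] =
   \sum_(p : 'S_2) [forall j, ~~ pareto_dominated g.2 j ==> (g.1 j == p)] :> nat)%N.
Proof.
have [j0 u0] := pareto_undominated_exists g.2.
rewrite (bigD1 (g.1 j0)) //= [X in (_ + X)%N]big1 ?addn0 => [|p ne]; last first.
  case: forallP => // /(_ j0); rewrite u0 /= eq_sym => /eqP e.
  by rewrite e eqxx in ne.
congr nat_of_bool; apply/asboolP/forallP => [sol j|una].
  apply/implyP => uj; apply/eqP; apply: contrapT => ne.
  exact: (not_solvable_if_disagree uj u0 ne).
apply: (@solvable_if_unanimous _ _ (g.1 j0) j0) => j uj.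
by apply/eqP; have := una j; rewrite uj.
Qed.

(** Given [p] and Column's payoffs, Row's permutations are chosen column by column: two ways for a
    dominated column, one for an undominated one. The leading 2 counts the choices of [p]. *)
Lemma card_solvable n :
  #|finset (fun g : game 2 n.+1 =>
      `[< strict_dominance_solvable (row_payoff g) (col_payoff g) >])| =
  (2 * (n.+1`! * odd_dfact n.+1))%N.
Proof.
rewrite -sum1_card big_mkcond /=.
rewrite (eq_bigr (fun g : game 2 n.+1 => \sum_(p : 'S_2)
  [forall j, ~~ pareto_dominated g.2 j ==> (g.1 j == p)] : nat)%N); last first.
  by move=> g _; rewrite inE -solvableE; case: asbool.
rewrite -(pair_bigA _ (fun (f : {ffun 'I_n.+1 -> 'S_2}) h => \sum_(p : 'S_2)
  [forall j, ~~ pareto_dominated h j ==> (f j == p)] : nat)%N) /=.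
rewrite exchange_big /= -sum_pareto_dominated big_distrr /=.
apply: eq_bigr => h _; rewrite exchange_big /=.
rewrite -[X in (X * _)%N](_ : #|'S_2| = 2)%N; last by rewrite card_Sn.
rewrite -sum_nat_const; apply: eq_bigr => p _.
under eq_bigr => f _ do rewrite -prod_nat_of_bool.
rewrite -(bigA_distr_bigA (fun j x => (~~ pareto_dominated h j ==> (x == p) : nat)))%N.
apply: eq_bigr => j _; case: pareto_dominated => /=.
  by rewrite sum1_card card_Sn.
by rewrite (bigD1 p) //= eqxx big1 // => q /negbTE ->.
Qed.

Lemma even_dfactE n : even_dfact n = (2 ^ n * n`!)%N.
Proof.
elim: n => [|n IH]; first by rewrite /even_dfact big_ord0.
rewrite /even_dfact big_ord_recr /= -/(even_dfact n) IH factS expnS addn1; ring.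
Qed.

(** There are [2 ^ n * n! ^ 2] games; one [n!] cancels, and [2 ^ n * n!] is [(2n)!!]. *)
Lemma solvable_prob2E (K : realType) n :
  (1 <= n)%N -> solvable_prob K 2 n = 2 * wallis_ratio K n.
Proof.
case: n => // n _; rewrite /solvable_prob card_solvable /wallis_ratio even_dfactE.
rewrite card_prod !card_ffun !card_Sn !card_ord (_ : 2`! = 2)%N //.
move: (n.+1)`! (fact_gt0 n.+1) => f f_gt0.
have f0 : f%:R != 0 :> K by rewrite pnatr_eq0 -lt0n.
have p0 : 2 ^+ n.+1 != 0 :> K by rewrite expf_neq0.
rewrite !natrM !natrX; move: (2 ^+ n.+1 : K) p0 => p p0.
by field; rewrite f0 p0.
Qed.

(** * Wallis bounds *)

(* Defined by integration by parts; keeping the antiderivatives explicit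
   avoids integrals in the proof of the Wallis bounds. *)
Fixpoint sinX_primitive (K : realType) (n : nat) : K -> K :=
  match n with
  | 0 => id
  | 1 => - cos
  | n'.+2 => (n'.+2%:R)^-1 \*:
      (n'.+1%:R \*: sinX_primitive n' - cos * sin ^+ n'.+1)
  end.
Arguments sinX_primitive : clear implicits.

Lemma is_derive_sinX_primitive (K : realType) n (x : K) :
  is_derive x 1 (sinX_primitive K n) (sin x ^+ n).
Proof.
(* The recursion goes back two exponents, so the induction carries two consecutive ones. *)
suff: is_derive x 1 (sinX_primitive K n) (sin x ^+ n) /\
      is_derive x 1 (sinX_primitive K n.+1) (sin x ^+ n.+1) by case.
elim: n => [|n [IH0 IH1]]; split => //.
- by rewrite expr0; exact: is_derive_id.
- by apply: is_derive_eq; rewrite expr1 opprK.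
change (sinX_primitive K n.+2) with
  ((n.+2%:R)^-1 \*: (n.+1%:R \*: sinX_primitive K n - cos * sin ^+ n.+1)).
apply: is_derive_eq.
rewrite fctE /GRing.scale /= !exprS.
have c2 : cos x * cos x = 1 - sin x * sin x :> K.
  by have := cos2Dsin2 x; rewrite !expr2 => /(canRL (addrK _)).
have n2 : n.+2%:R != 0 :> K by rewrite pnatr_eq0.
apply: (canLR (mulKf n2)); rewrite -[n.+2%:R]natr1.
(* Isolates the squared cosine from the product rule, to be replaced through [c2]. *)
transitivity (n.+1%:R * sin x ^+ n - n.+1%:R * sin x ^+ n * (cos x * cos x)
   + sin x * sin x ^+ n * sin x); first by ring.
by rewrite c2; ring.
Qed.

Definition sinX_integral (K : realType) (n : nat) : K :=
  sinX_primitive K n (pi / 2) - sinX_primitive K n 0.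

Lemma sinX_integral0 (K : realType) : sinX_integral K 0 = pi / 2.
Proof. exact: subr0. Qed.

Lemma sinX_integral1 (K : realType) : sinX_integral K 1 = 1.
Proof. by rewrite /sinX_integral /= !fctE cos_pihalf cos0 oppr0 sub0r opprK. Qed.

(** The boundary term [cos * sin ^+ n.+1] vanishes at both 0 and [pi / 2]. *)
Lemma sinX_integralSS (K : realType) n :
  n.+2%:R * sinX_integral K n.+2 = n.+1%:R * sinX_integral K n.
Proof.
rewrite /sinX_integral /= !fctE cos_pihalf sin0 /GRing.scale /= expr0n /=. 
by rewrite /GRing.scale /= mulrBr !(mulVKf (_ : n.+2%:R != 0)) ?pnatr_eq0 //; ring.
Qed.

(** The difference [F] of the primitives has derivative [sin x ^+ n * (1 - sin x)], nonnegative on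
    the interval. *)
Lemma sinX_integral_le (K : realType) n :
  sinX_integral K n.+1 <= sinX_integral K n.
Proof.
set F := sinX_primitive K n - sinX_primitive K n.+1.
have dF (x : K) : is_derive x 1 F (sin x ^+ n - sin x ^+ n.+1).
  by apply: is_deriveB; exact: is_derive_sinX_primitive.
have pi2 : 0 <= pi / 2 :> K by rewrite divr_ge0 // pi_ge0.
suff : F 0 <= F (pi / 2) by rewrite /F /sinX_integral !fctE; lra.
apply: (@ger0_derive1_le_cc _ F 0 (pi / 2)) => //.
- move=> x /[!in_itv] /= /andP[x0 xpi]; rewrite derive1E derive_val.
  have s0 : 0 <= sin x.
    by apply: sin_ge0_pi; rewrite ltW //=; have := pi_ge0 K; lra.
  by rewrite exprSr -{1}[sin x ^+ n]mulr1 -mulrBr mulr_ge0 ?exprn_ge0 // subr_ge0 sin_le1.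
- by apply: derivable_within_continuous => x _; exact: ex_derive.
- by rewrite bound_itvE.
- by rewrite bound_itvE.
Qed.

(** * The Wallis ratio and its relation to the integrals *)

Lemma wallis_ratio_gt0 (K : realType) n : 0 < wallis_ratio K n.
Proof.
rewrite divr_gt0 // ltr0n prodn_gt0 // => k; first by rewrite addn1.
by rewrite muln_gt0 addn1.
Qed.

Lemma wallis_ratio0 (K : realType) : wallis_ratio K 0 = 1.
Proof. by rewrite /wallis_ratio /odd_dfact /even_dfact !big_ord0 divr1. Qed.

Lemma wallis_ratioS (K : realType) n :
  n.*2.+2%:R * wallis_ratio K n.+1 = n.*2.+1%:R * wallis_ratio K n.
Proof.
have e0 : (even_dfact n)%:R != 0 :> K.
  by rewrite pnatr_eq0 -lt0n prodn_gt0 // => k; rewrite muln_gt0 addn1.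
rewrite /wallis_ratio /odd_dfact /even_dfact !big_ord_recr /=.
rewrite -/(odd_dfact n) -/(even_dfact n) 2!natrM !mul2n !addn1.
rewrite -[n.*2.+2]/(n.+1.*2).
have : n.+1.*2%:R != 0 :> K by rewrite pnatr_eq0.
move: (n.+1.*2%:R : K) (n.*2.+1%:R : K) => d d' d0.
by field; rewrite e0 d0.
Qed.

Lemma wallis_ratio_ltS (K : realType) n : wallis_ratio K n.+1 < wallis_ratio K n.
Proof.
have d0 : 0 < n.*2.+2%:R :> K by [].
by rewrite -(ltr_pM2l d0) wallis_ratioS ltr_pM2r ?wallis_ratio_gt0 // ltr_nat.
Qed.

Lemma sinX_integral_even (K : realType) n :
  sinX_integral K n.*2 = pi / 2 * wallis_ratio K n.
Proof.
elim: n => [|n IH]; first by rewrite sinX_integral0 wallis_ratio0 mulr1.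
have d0 : n.*2.+2%:R != 0 :> K by rewrite pnatr_eq0.
apply: (mulfI d0); rewrite doubleS sinX_integralSS IH.
by rewrite mulrCA [RHS]mulrCA wallis_ratioS.
Qed.

(** The recurrences of the ratio and of the odd integrals cancel, so the product keeps its value at
    [n = 0]. *)
Lemma sinX_integral_odd (K : realType) n :
  n.*2.+1%:R * wallis_ratio K n * sinX_integral K n.*2.+1 = 1.
Proof.
elim: n => [|n IH]; first by rewrite wallis_ratio0 sinX_integral1 !mulr1.
by rewrite doubleS -mulrA mulrCA sinX_integralSS mulrA [X in X * _]mulrC wallis_ratioS.
Qed.

(** For [n > 0], write I(k) for the integrals: I(2n+1) <= I(2n) <= I(2n-1), where the middle is
    [pi / 2 * W(n)] and the outer ones are [1 / ((2n + 1) W(n))] and [1 / (2n W(n))]. *)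
Lemma wallis_ratio_sqr_bounds (K : realType) n :
  2 * n%:R / ((2 * n%:R + 1) * pi) <= n%:R * wallis_ratio K n ^+ 2 <= pi^-1.
Proof.
have pi0 : 0 < pi :> K by exact: pi_gt0.
case: n => [|n]; first by rewrite mulr0 !mul0r lexx invr_ge0 ltW.
have W0 := wallis_ratio_gt0 K n.+1; set W := wallis_ratio K n.+1 in W0 *.
have odd1 := sinX_integral_odd K n.+1; rewrite -/W in odd1.
have even1 := sinX_integral_even K n.+1; rewrite -/W in even1.
have le1 := sinX_integral_le K n.+1.*2; have le2 := sinX_integral_le K n.*2.+1.
have rec := sinX_integralSS K n.*2.+1.
rewrite doubleS in odd1 even1 le1.
(* [a], [b], [c] are the integrals for exponents [2x + 1], [2x], [2x - 1], with [x = n + 1]. *)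
move: (sinX_integral K n.*2.+3) (sinX_integral K n.*2.+2)
  (sinX_integral K n.*2.+1) odd1 even1 le1 le2 rec => a b c.
set x : K := n.+1%:R.
have x0 : 0 < x by rewrite ltr0n.
have -> : n.*2.+3%:R = 2 * x + 1 :> K.
  by rewrite /x -natrM natr1 mul2n doubleS.
have -> : n.*2.+2%:R = 2 * x :> K by rewrite /x -natrM mul2n doubleS.
move=> odd1 -> le1 le2 rec.
apply/andP; split.
  rewrite ler_pdivrMr; last by rewrite mulr_gt0 //; lra.
  have -> : x * W ^+ 2 * ((2 * x + 1) * pi) = 2 * x * ((2 * x + 1) * W * (pi / 2 * W)).
    by field.
  rewrite ler_peMr //; first lra.
  have d0 : 0 < (2 * x + 1) * W by rewrite mulr_gt0 //; lra.
  by rewrite -[leLHS]odd1 ler_pM2l.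
rewrite -[leRHS]mul1r ler_pdivlMr //.
have -> : x * W ^+ 2 * pi = 2 * x * W * (pi / 2 * W) by field.
have d0 : 0 < 2 * x * W by apply: mulr_gt0 => //; lra.
apply: (@le_trans _ _ (2 * x * W * c)); first by rewrite ler_pM2l.
by rewrite mulrAC -rec mulrAC odd1.
Qed.

(** Squeeze [n W(n)^2] towards [1 / pi], then use continuity of the square root. *)
Lemma cvg_sqrt_wallis_ratio (K : realType) :
  Num.sqrt n%:R * wallis_ratio K n @[n --> \oo] --> (Num.sqrt (pi : K))^-1.
Proof.
have pi0 : 0 < pi :> K by exact: pi_gt0.
have E n : Num.sqrt (n%:R * wallis_ratio K n ^+ 2) = Num.sqrt n%:R * wallis_ratio K n.
  by rewrite sqrtrM ?ler0n // sqrtr_sqr ger0_norm // ltW // wallis_ratio_gt0.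
rewrite -sqrtrV ?ltW //; under eq_fun do rewrite -E.
apply: continuous_cvg; first exact: sqrt_continuous.
apply: (@squeeze_cvgr _ _ _ _ (fun n => 2 * n%:R / ((2 * n%:R + 1) * pi)) (fun=> pi^-1)).
- by near=> n; exact: wallis_ratio_sqr_bounds.
- have -> : (fun n => 2 * n%:R / ((2 * n%:R + 1) * pi)) =
      (fun n => pi^-1 - pi^-1 * (2 * n%:R + 1)^-1 :> K).
    apply/funext => n; have d0 : 2 * n%:R + 1 != 0 :> K.
      by rewrite gt_eqF // ltr_wpDl // mulr_ge0.
    by move: (pi : K) (lt0r_neq0 pi0) => p p0; field; rewrite d0.
  suff : pi^-1 - pi^-1 * (2 * n%:R + 1 : K)^-1 @[n --> \oo] --> pi^-1 - pi^-1 * 0.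
    by rewrite mulr0 subr0.
  apply: cvgB; first exact: cvg_cst.
  apply: cvgM; first exact: cvg_cst.
  (* [harmonic] is [1 / (n + 1)], which bounds [1 / (2n + 1)] from above. *)
  apply: (@squeeze_cvgr _ _ _ _ (fun=> 0) (@harmonic K)); last exact: cvg_harmonic.
    near=> n; have n0 : 0 <= n%:R :> K by exact: ler0n.
    by rewrite invr_ge0 lef_pV2 ?posrE -?natr1; lra.
  exact: cvg_cst.
- exact: cvg_cst.
Unshelve. all: by end_near.
Qed.

Theorem proposition1 (K : realType) :
  [/\ (forall n : nat, (1 <= n)%N ->
         solvable_prob K 2 n = 2 * wallis_ratio K n /\
         2 * wallis_ratio K n
           = (odd_dfact n)%:R / (2 ^+ (n - 1) * (n`!)%:R)),
      (forall n1 n2 : nat, (1 <= n1)%N -> (n1 < n2)%N ->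
         solvable_prob K 2 n2 < solvable_prob K 2 n1) &
      Num.sqrt n%:R * solvable_prob K 2 n @[n --> \oo]
        --> 2 / Num.sqrt (pi : K)].
Proof.
split.
- move=> n n1; split; first exact: solvable_prob2E.
  case: n n1 => // n _; rewrite subSS subn0 /wallis_ratio even_dfactE natrM natrX exprS.
  by field; rewrite expf_neq0 // pnatr_eq0 -lt0n fact_gt0.
- move=> n1 n2 n1_gt0 lt12.
  rewrite !solvable_prob2E //; last exact: leq_trans lt12.
  rewrite ltr_pM2l //.
  apply: (homo_ltn (r := fun x y => y < x)) lt12 => [y x z|n].
    by move=> xy yz; exact: lt_trans yz xy.
  exact: wallis_ratio_ltS.
- suff -> : (fun n => Num.sqrt n%:R * solvable_prob K 2 n) =
      (fun n => 2 * (Num.sqrt n%:R * wallis_ratio K n)).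
    exact: cvgM (cvg_cst _) (@cvg_sqrt_wallis_ratio K).
  (* The probability formula needs [n >= 1]; at [n = 0] the factor [Num.sqrt 0] makes both sides
     0. *)
  apply/funext => -[|n]; first by rewrite sqrtr0 !mul0r mulr0.
  by rewrite solvable_prob2E // mulrCA.
Qed.
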